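(* Let $\alpha$ be an automorphism of $\mathcal{Q}_2$ such that $\alpha(U)=zU$ for some $z\in\mathbb{T}$. Then $z^{2^n}=1$ for some $n\in\mathbb{N}$ (with $0\in\mathbb{N}$).
   Context: The $2$-adic ring $C^*$-algebra $\mathcal{Q}_2$ is the universal $C^*$-algebra generated by a unitary $U$ and an isometry $S_2$ such that $S_2U=U^2S_2$ and $S_2S_2^*+US_2S_2^*U^*=1$. Automorphisms are $*$-automorphisms; $\mathbb{T}$ is the unit circle in $\mathbb{C}$. *)

(* Defs.v *)
From HB Require Import structures.
From mathcomp Require Import all_boot all_order all_algebra.
From mathcomp Require Import complex.
From mathcomp Require Import all_classical all_reals all_analysis.

Set Implicit Arguments.
Unset Strict Implicit.
Unset Printing Implicit Defensive.

Import Order.TTheory GRing.Theory Num.Theory.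
Import numFieldNormedType.Exports.

Local Open Scope classical_set_scope.
Local Open Scope ring_scope.
Local Open Scope complex_scope.

(* MathComp-Analysis normed modules cannot be joined with MathComp algebras   *)
(* (every ring with a norm is a numDomainType there), so the norm is a field  *)
(* of the structure. MathComp algebras satisfy 1 != 0, which excludes the     *)
(* zero algebra.                                                              *)
HB.mixin Record Algebra_isCstar (R : realType) A & GRing.Algebra R[i] A := {
  adj : A -> A;
  cnorm : A -> R;
  adjK : forall x, adj (adj x) = x;
  adjD : forall x y, adj (x + y) = adj x + adj y;
  adjZ : forall (a : R[i]) x, adj (a *: x) = Num.conj a *: adj x;
  adjM : forall x y, adj (x * y) = adj y * adj x;
  cnorm_eq0 : forall x, cnorm x = 0 -> x = 0;
  cnormD : forall x y, cnorm (x + y) <= cnorm x + cnorm y;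
  cnormZ : forall (a : R[i]) x, cnorm (a *: x) = Normc.normc a * cnorm x;
  cnormM : forall x y, cnorm (x * y) <= cnorm x * cnorm y;
  cnorm_complete : forall u : nat -> A,
    (forall e : R, 0 < e ->
       exists N : nat, forall m n : nat, (N <= m)%N -> (N <= n)%N ->
         cnorm (u m - u n) < e) ->
    exists l : A, cnorm (u n - l) @[n --> \oo] --> (0 : R);
  cnorm_adj : forall x, cnorm (adj x * x) = cnorm x ^+ 2;
}.

#[short(type="cstarAlgType")]
HB.structure Definition CstarAlgebra (R : realType) :=
  {A of GRing.Algebra R[i] A & Algebra_isCstar R A}.

Section CstarAlgebraDefs.
Variable R : realType.

Definition unitary (A : cstarAlgType R) (u : A) : Prop :=
  adj u * u = 1 /\ u * adj u = 1.

Definition isometry (A : cstarAlgType R) (s : A) : Prop := adj s * s = 1.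

Definition star_hom (A B : cstarAlgType R) (f : A -> B) : Prop :=
  [/\ linear f, monoid_morphism f & forall x, f (adj x) = adj (f x)].

Definition star_automorphism (A : cstarAlgType R) (f : A -> A) : Prop :=
  star_hom f /\ bijective f.

Definition closed_star_subalgebra (A : cstarAlgType R) (P : set A) : Prop :=
  [/\ forall (u : nat -> A) (l : A), (forall n, P (u n)) ->
        cnorm (u n - l) @[n --> \oo] --> (0 : R) -> P l,
      P 1,
      forall (a : R[i]) x y, P x -> P y -> P (a *: x + y),
      forall x y, P x -> P y -> P (x * y) &
      forall x, P x -> P (adj x)].

Definition cstar_generates (A : cstarAlgType R) (G : set A) : Prop :=
  forall P : set A, closed_star_subalgebra P -> G `<=` P -> P = setT.

Definition Q2_relations (A : cstarAlgType R) (U S : A) : Prop :=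
  [/\ unitary U,
      isometry S,
      S * U = U ^+ 2 * S &
      S * adj S + U * S * adj S * adj U = 1].

(* A, with its elements U and S, is the 2-adic ring C*-algebra. The           *)
(* *-homomorphism f is unique, because U and S generate A and                 *)
(* *-homomorphisms of C*-algebras are continuous.                             *)
Definition is_Q2 (A : cstarAlgType R) (U S : A) : Prop :=
  [/\ Q2_relations U S,
      cstar_generates [set U; S] &
      forall (B : cstarAlgType R) (u s : B), Q2_relations u s ->
        exists f : A -> B, [/\ star_hom f, f U = u & f S = s]].

End CstarAlgebraDefs.

(* Main.v *)
Require Import Defs.
From HB Require Import structures.
From mathcomp Require Import all_boot all_order all_algebra.
From mathcomp Require Import complex.
From mathcomp Require Import all_classical all_reals all_analysis.
From mathcomp Require Import zify ring lra.

Set Implicit Arguments.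
Unset Strict Implicit.
Unset Printing Implicit Defensive.

Import Order.TTheory GRing.Theory Num.Theory.
Import numFieldNormedType.Exports.

Local Open Scope ring_scope.
Local Open Scope complex_scope.

(** The image T of S2 under alpha is an isometry with T U = z U^2 T, that is,
    a fixed point of the contraction twist : y |-> z^-1 U*^2 y U.  The claim
    is that, unless z is a root of unity of order a power of 2, no isometry is
    fixed by twist ([no_twist_fixed_isometry]).

    The reason is best seen in the representation on l^2(Z) with U e_t = e_{t+1}
    and S e_t = e_{2t}.  A word in U, U*, S, S* acts there on indices as a
    partial affine map t |-> (2^k t + p) / 2^l.  Conjugation of a word as in
    twist adds 2^k - 2^{l+1} to p, so there are two cases.  If k <> l+1, the
    iterates of twist send e_0 to multiples of distinct basis vectors, or to 0.
    If k = l+1, the word is an eigenvector of the 2^l-th iterate, for the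
    eigenvalue z^{-2^l} <> 1.  In both cases the sum of the first N iterates,
    paired with any other word in the vector state of e_0, is bounded
    independently of N.  Words span a dense subspace.  For a fixed isometry T
    the sum is N T, and pairing it with T* would give N.

    No representation is needed to carry this out: the vector state of e_0 is
    replaced by the contractions y |-> S*^m y S^m ([corner]) for large m.  They
    fix 1, and kill every word with p <> 0 when m is large enough
    ([monomial_vanish]).  The bound on pairs of words is
    [corner_bounded_eigen] and [corner_bounded_drift]; [word_span_dense] gives
    the density. *)

(** * Preliminaries on numbers *)

Lemma normc_ge0 (R : realType) (a : R[i]) : 0 <= Normc.normc a.
Proof. by case: a => a b; exact: sqrtr_ge0. Qed.

Lemma normcX (R : realType) (a : R[i]) n : Normc.normc (a ^+ n) = Normc.normc a ^+ n.
Proof.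
elim: n => [|n IH]; first by rewrite Normc.normc1.
by rewrite !exprS Normc.normcM IH.
Qed.

Lemma exists_small_factor (R : realType) (c e : R) : 0 <= c -> 0 < e ->
  exists2 d, 0 < d & c * d <= e.
Proof.
move=> c0 e0; have c1 : 0 < c + 1 by lra.
exists (e / (c + 1)); first exact: divr_gt0.
by rewrite mulrCA ger_pMr // ler_pdivrMr // mul1r lerDl.
Qed.

Lemma int_parity (t : int) : exists q, t = 2 * q \/ t = 2 * q + 1.
Proof. by exists (t %/ 2)%Z; lia. Qed.

Lemma uniform_eventually (Q : nat -> nat -> Prop) N :
  (forall r, exists m0, forall m, (m0 <= m)%N -> Q r m) ->
  exists m0, forall m, (m0 <= m)%N -> forall r, (r < N)%N -> Q r m.
Proof.
move=> hQ; elim: N => [|N [m1 h1]]; first by exists 0.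
have [m2 h2] := hQ N; exists (maxn m1 m2) => m.
rewrite geq_max => /andP[/h1 h1m /h2 h2m] r.
by rewrite ltnS leq_eqVlt => /orP[/eqP ->|/h1m].
Qed.

(** * Norms in C*-algebras *)

Section CstarNorm.
Variables (R : realType) (A : cstarAlgType R).
Implicit Types x y : A.

Lemma adj0 : adj (0 : A) = 0.
Proof.
by have := @adjD R A 0 0; rewrite addr0 -{1}[adj 0]addr0 => /addrI.
Qed.

Lemma adj1 : adj (1 : A) = 1.
Proof. by rewrite -[LHS]mul1r -{1}[1]adjK -adjM mul1r adjK. Qed.

Lemma adjX x n : adj (x ^+ n) = adj x ^+ n.
Proof. by elim: n => [|n IH]; rewrite ?adj1 // exprS adjM IH -exprSr. Qed.

Lemma cnorm0 : cnorm (0 : A) = 0.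
Proof. by rewrite -(scale0r (0 : A)) cnormZ Normc.normc0 mul0r. Qed.

Lemma cnormN x : cnorm (- x) = cnorm x.
Proof. by rewrite -scaleN1r cnormZ normcN Normc.normc1 mul1r. Qed.

Lemma cnormMn x n : cnorm (x *+ n) = cnorm x *+ n.
Proof.
by rewrite -(scaler_nat n x) cnormZ (normcMn 1 n) Normc.normc1 mulr_natl.
Qed.

Lemma cnorm_ge0 x : 0 <= cnorm x.
Proof.
have := cnormD x (- x); rewrite subrr cnorm0 cnormN => h.
by lra.
Qed.

Lemma cnorm1 : cnorm (1 : A) = 1.
Proof.
have := @cnorm_adj R A 1; rewrite adj1 mul1r expr2 => h.
have n0 : cnorm (1 : A) != 0.
  by apply/eqP => /cnorm_eq0/eqP; rewrite oner_eq0.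
by apply: (mulfI n0); rewrite -h mulr1.
Qed.

Lemma isometryX x n : Defs.isometry x -> adj x ^+ n * x ^+ n = 1.
Proof.
move=> hx; elim: n => [|n IH]; first by rewrite mulr1.
by rewrite exprSr exprS mulrA -[X in X * _]mulrA hx mulr1.
Qed.

Lemma cnorm_isometry x : Defs.isometry x -> cnorm x = 1.
Proof.
move=> hx; apply/eqP; rewrite -(@eqrXn2 _ 2) ?cnorm_ge0 //.
by rewrite expr1n -cnorm_adj hx cnorm1.
Qed.

Lemma cnorm_le_adj x : cnorm x <= cnorm (adj x).
Proof.
have [->|x0] := eqVneq (cnorm x) 0; first exact: cnorm_ge0.
have xp : 0 < cnorm x by rewrite lt_def x0 cnorm_ge0.
by rewrite -(ler_pM2r xp) -expr2 -cnorm_adj cnormM.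
Qed.

Lemma cnorm_adjE x : cnorm (adj x) = cnorm x.
Proof.
by apply/eqP; rewrite eq_le cnorm_le_adj andbT -{2}[x]adjK cnorm_le_adj.
Qed.

Lemma cnormB x y : cnorm (x - y) <= cnorm x + cnorm y.
Proof. by rewrite -[cnorm y]cnormN cnormD. Qed.

Lemma cnorm_mull_le x y : cnorm x <= 1 -> cnorm (x * y) <= cnorm y.
Proof.
move=> hx; apply: le_trans (cnormM _ _) _.
by rewrite -[leRHS]mul1r ler_wpM2r ?cnorm_ge0.
Qed.

Lemma cnorm_mulr_le x y : cnorm y <= 1 -> cnorm (x * y) <= cnorm x.
Proof.
move=> hy; apply: le_trans (cnormM _ _) _.
by rewrite -[leRHS]mulr1 ler_wpM2l ?cnorm_ge0.
Qed.

Lemma cnorm_expr_le1 x n : cnorm x <= 1 -> cnorm (x ^+ n) <= 1.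
Proof.
move=> hx; elim: n => [|n IH]; first by rewrite expr0 cnorm1.
by rewrite exprS; apply: le_trans (cnorm_mull_le _ hx) IH.
Qed.

Lemma cnorm_sum (I : Type) (s : seq I) (F : I -> A) :
  cnorm (\sum_(i <- s) F i) <= \sum_(i <- s) cnorm (F i).
Proof.
elim/big_ind2: _ => [|x a y b hx hy|//]; first by rewrite cnorm0.
by apply: le_trans (cnormD _ _) (lerD hx hy).
Qed.

Lemma cnorm_sum_le (N : nat) (F : nat -> A) (c : R) :
  (forall r, cnorm (F r) <= c) -> cnorm (\sum_(r < N) F r) <= N%:R * c.
Proof.
move=> hF; apply: le_trans (cnorm_sum _ _) _.
apply: (@le_trans _ _ (\sum_(r < N) c)); first by apply: ler_sum.
by rewrite sumr_const card_ord mulr_natl.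
Qed.

End CstarNorm.

(** * Words in the generators *)

Section Q2Words.
Variables (R : realType) (A : cstarAlgType R) (U S : A).
Hypothesis hrel : Q2_relations U S.

Let UVU : adj U * U = 1. Proof. by case: hrel => -[]. Qed.
Let UUV : U * adj U = 1. Proof. by case: hrel => -[]. Qed.
Let SS : adj S * S = 1. Proof. by case: hrel. Qed.
Let SU : S * U = U ^+ 2 * S. Proof. by case: hrel. Qed.

(** The ranges of S and U S are orthogonal: compressing the second projection
    U S S* U* = 1 - S S* by S gives X X* = 0 for X = S* U S, and the
    C*-identity concludes. *)
Lemma adjS_U_S : adj S * U * S = 0.
Proof.
have h0 : (adj S * U * S) * adj (adj S * U * S) = 0.
  have [_ _ _ h] := hrel.
  have e : U * S * adj S * adj U = 1 - S * adj S by rewrite -h addrC addKr.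
  rewrite !adjM adjK.
  transitivity (adj S * (U * S * adj S * adj U) * S); first by rewrite !mulrA.
  by rewrite e mulrBr mulr1 mulrBl !mulrA SS mul1r SS subrr.
rewrite -[LHS]adjK -[RHS]adj0; congr adj; apply: cnorm_eq0.
by apply/eqP; rewrite -sqrf_eq0 -cnorm_adj adjK h0 cnorm0.
Qed.

Definition Upow (i : int) : A :=
  match i with Posz n => U ^+ n | Negz n => adj U ^+ n.+1 end.

Lemma UpowS i : Upow (i + 1) = U * Upow i.
Proof.
case: i => n; first by rewrite -PoszD addn1 /= exprS.
case: n => [|n]; first by rewrite /= expr1 UUV.
have -> : Negz n.+1 + 1 = Negz n by lia.
by rewrite /= [in RHS]exprS mulrA UUV mul1r.
Qed.

Lemma UpowP i : Upow (i - 1) = adj U * Upow i.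
Proof. by rewrite -[in RHS](subrK 1 i) UpowS mulrA UVU mul1r. Qed.

Lemma UpowD i j : Upow (i + j) = Upow i * Upow j.
Proof.
elim/int_rect: i => [|n IH|n IH]; first by rewrite add0r mul1r.
  have -> : (n.+1 : int) = n%:Z + 1 by lia.
  by rewrite addrAC !UpowS IH mulrA.
have -> : - (n.+1 : int) = - n%:Z - 1 by lia.
by rewrite addrAC !UpowP IH mulrA.
Qed.

Lemma adj_Upow i : adj (Upow i) = Upow (- i).
Proof.
case: i => [[|n]|n]; first by rewrite oppr0 /= adj1.
  by rewrite -NegzE /= adjX.
by rewrite NegzE opprK -NegzE /= adjX adjK.
Qed.

Lemma S_Upow i : S * Upow i = Upow (2 * i) * S.
Proof.
have SV : S * adj U = adj U ^+ 2 * S.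
  transitivity (adj U ^+ 2 * (U ^+ 2 * S) * adj U).
    by rewrite mulrA isometryX // mul1r.
  by rewrite -SU -!mulrA UUV mulr1.
elim/int_rect: i => [|n IH|n IH]; first by rewrite mulr0 mulr1 mul1r.
  have -> : (n.+1 : int) = n%:Z + 1 by lia.
  have -> : 2 * (n%:Z + 1) = 2 * n%:Z + 1 + 1 :> int by lia.
  by rewrite !UpowS mulrA SU -mulrA IH expr2 !mulrA.
have -> : - (n.+1 : int) = - n%:Z - 1 by lia.
have -> : 2 * (- n%:Z - 1) = 2 * (- n%:Z) - 1 - 1 :> int by lia.
by rewrite !UpowP mulrA SV -mulrA IH expr2 !mulrA.
Qed.

Lemma adjS_Upow i : adj S * Upow (2 * i) = Upow i * adj S.
Proof.
have := congr1 (@adj _ _) (S_Upow (- i)).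
by rewrite !adjM !adj_Upow mulrN !opprK.
Qed.

Lemma adjS_Upow_odd i : adj S * Upow (2 * i + 1) * S = 0.
Proof.
by rewrite UpowD mulrA adjS_Upow -!mulrA (mulrA (adj S)) /= adjS_U_S mulr0.
Qed.

(** In the model on l^2(Z), S^n e_t = e_{2^n t}, so the compression of a
    translation by t vanishes unless 2^n divides t. *)
Lemma adjSX_Upow_SX n t :
  adj S ^+ n * Upow t * S ^+ n != 0 -> exists q, t = 2 ^+ n * q.
Proof.
elim: n t => [|n IH] t; first by exists t; rewrite mul1r.
have -> : adj S ^+ n.+1 * Upow t * S ^+ n.+1 =
          adj S ^+ n * (adj S * Upow t * S) * S ^+ n.
  by rewrite exprSr exprS !mulrA.
have [q [->|->]] := int_parity t.
  rewrite adjS_Upow -[X in _ * X * _]mulrA SS mulr1 => /IH [q' ->].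
  by exists q'; rewrite exprS mulrA.
by rewrite adjS_Upow_odd mulr0 mul0r eqxx.
Qed.

(** The indices k, l, p record the partial affine map t |-> (2^k t + p) / 2^l
    by which the word moves the basis of l^2(Z).  They belong to the way the
    word is written: both S* S and 1 are words, with different indices. *)
Inductive monomial : nat -> nat -> int -> A -> Prop :=
| Mono1 : monomial 0 0 0 1
| MonoU : monomial 0 0 1 U
| MonoV : monomial 0 0 (-1) (adj U)
| MonoS : monomial 1 0 0 S
| MonoT : monomial 0 1 0 (adj S)
| MonoM k1 l1 p1 k2 l2 p2 x y : monomial k1 l1 p1 x -> monomial k2 l2 p2 y ->
    monomial (k1 + k2) (l1 + l2) (2 ^+ k1 * p2 + 2 ^+ l2 * p1) (x * y).

Lemma monomial_adj k l p x : monomial k l p x -> monomial l k (- p) (adj x).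
Proof.
elim=> {k l p x}[|||||k1 l1 p1 k2 l2 p2 x y _ hx _ hy].
- by rewrite adj1 oppr0; exact: Mono1.
- exact: MonoV.
- by rewrite adjK opprK; exact: MonoU.
- by rewrite oppr0; exact: MonoT.
- by rewrite adjK oppr0; exact: MonoS.
have := MonoM hy hx.
by rewrite adjM (addnC l2) (addnC k2) !mulrN -opprD addrC.
Qed.

Lemma cnorm_monomial k l p x : monomial k l p x -> cnorm x <= 1.
Proof.
elim=> {k l p x}[|||||k1 l1 p1 k2 l2 p2 x y _ hx _ hy].
- by rewrite cnorm1.
- by rewrite cnorm_isometry.
- by rewrite cnorm_isometry // /Defs.isometry adjK.
- by rewrite cnorm_isometry.
- by rewrite cnorm_adjE cnorm_isometry.
by apply: le_trans (cnorm_mull_le _ hx) hy.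
Qed.

(** The elements U^t S^m play the part of the basis vectors e_t; the exponent
    m must start large enough to absorb each S* of the word. *)
Lemma monomial_act k l p x : monomial k l p x -> forall t m,
  x * (Upow t * S ^+ (m + l)) = 0 \/
  exists2 t', 2 ^+ l * t' = 2 ^+ k * t + p &
              x * (Upow t * S ^+ (m + l)) = Upow t' * S ^+ (m + k).
Proof.
elim=> {k l p x}[|||||k1 l1 p1 k2 l2 p2 x y _ hx _ hy] t m.
- by right; exists t; rewrite ?addr0 ?mul1r.
- by right; exists (t + 1); rewrite ?mul1r // UpowS mulrA.
- by right; exists (t - 1); rewrite ?mul1r // UpowP mulrA.
- right; exists (2 * t); first by rewrite addr0 mul1r expr1.
  by rewrite mulrA S_Upow -mulrA -exprS addn0 addn1.
- rewrite addn1 exprS !mulrA; have [q [->|->]] := int_parity t.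
    right; exists q; first by rewrite addr0 expr1 mul1r.
    by rewrite adjS_Upow -mulrA -mulrA (mulrA (adj S)) SS mul1r addn0.
  by left; rewrite adjS_Upow_odd mul0r.
rewrite addnA -mulrA.
have [->|[t2 e2 ->]] := hy t (m + l1)%N; first by left; rewrite mulr0.
rewrite addnAC.
have [->|[t1 e1 ->]] := hx t2 (m + k2)%N; first by left.
right; exists t1; last by rewrite addnAC addnA.
by rewrite !exprD -mulrA mulrCA e1 mulrDr mulrCA e2; ring.
Qed.

(** The word sends e_0 to 0 or to e_t with 2^l t = p.  Compression by S^m
    leaves only the t divisible by 2^(m-l), which for large m forces p = 0. *)
Lemma monomial_vanish k l p x : monomial k l p x -> p != 0 ->
  exists m0, forall m, (m0 <= m)%N -> adj S ^+ m * x * S ^+ m = 0.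
Proof.
move=> hx p0; exists (l + `|p|.+1)%N => m hm.
have -> : m = ((m - l) + l)%N by lia.
set j := (m - l)%N.
have := monomial_act hx 0 j; rewrite [Upow 0]/= mul1r -mulrA.
case=> [->|[t e ->]]; first by rewrite mulr0.
have -> : adj S ^+ (j + l) * (Upow t * S ^+ (j + k)) =
   adj S ^+ l * (adj S ^+ j * Upow t * S ^+ j) * S ^+ k.
  by rewrite addnC !exprD !mulrA.
have [->|/adjSX_Upow_SX [q tq]] :=
  eqVneq (adj S ^+ j * Upow t * S ^+ j) 0; first by rewrite mulr0 mul0r.
exfalso; move: e; rewrite mulr0 add0r tq => e.
have hlt : (`|p| < 2 ^ j)%N.
  by apply: leq_trans (ltn_expl _ (ltnSn 1)); rewrite ltnS /j; lia.
have hdvd : (2 ^ j %| `|p|)%N.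
  rewrite -e !abszM !abszX /= mulnCA; exact: dvdn_mulr.
have := dvdn_leq _ hdvd; rewrite absz_gt0 p0 => /(_ isT).
by rewrite leqNgt hlt.
Qed.

Lemma monomial_UX k l p x n : monomial k l p x ->
  x * U ^+ (2 ^ l * n) = U ^+ (2 ^ k * n) * x.
Proof.
move=> h; elim: h n => {k l p x}[|||||k1 l1 p1 k2 l2 p2 x y _ hx _ hy] n.
- by rewrite mulr1 mul1r.
- by rewrite -exprS exprSr.
- by apply: commrX; rewrite /GRing.comm UVU UUV.
- by rewrite mul1n; exact: (S_Upow n).
- by rewrite mul1n; exact: (adjS_Upow n).
rewrite -mulrA (addnC l1) expnD -mulnA hy mulnCA mulrA hx -mulrA.
by rewrite mulnA -expnD.
Qed.

(** Precomposing with t |-> t + r and postcomposing with t |-> t - 2r changes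
    p by r (2^k - 2^(l+1)). *)
Lemma monomial_conj k l p x r : monomial k l p x ->
  monomial k l (p + r%:Z * (2 ^+ k - 2 ^+ l.+1))
    (adj U ^+ (2 * r) * x * U ^+ r).
Proof.
move=> hx; elim: r => [|r IH]; first by rewrite mul0r addr0 mul1r mulr1.
have := MonoM MonoV (MonoM MonoV (MonoM IH MonoU)).
rewrite !add0n !addn0 !expr0 !mul1r mulr1.
rewrite mulnS exprD expr2 (exprSr U) !mulrA; congr monomial.
by rewrite exprS -[r.+1]addn1 PoszD; ring.
Qed.

(** * Density of the span of the words *)

Inductive word_span : A -> Prop :=
| Span0 : word_span 0
| SpanD a k l p x y : monomial k l p x -> word_span y -> word_span (a *: x + y).

Lemma word_span_linear a x y :
  word_span x -> word_span y -> word_span (a *: x + y).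
Proof.
move=> hx hy; elim: hx => [|b k l p w {}x hw _ IH]; first by rewrite scaler0 add0r.
by rewrite scalerDr scalerA -addrA; apply: SpanD hw IH.
Qed.

Lemma word_span_monomial k l p x : monomial k l p x -> word_span x.
Proof.
by move=> hx; rewrite -[x]addr0 -[x]scale1r; apply: SpanD hx Span0.
Qed.

Lemma word_spanM x y : word_span x -> word_span y -> word_span (x * y).
Proof.
move=> hx hy; elim: hx => [|a k l p w {}x hw _ IH]; first by rewrite mul0r; exact: Span0.
rewrite mulrDl -scalerAl; apply: word_span_linear IH.
elim: hy => [|b k' l' p' v {}y hv _ IH]; first by rewrite mulr0; exact: Span0.
by rewrite mulrDr -scalerAr; apply: SpanD (MonoM hw hv) IH.
Qed.

Lemma word_span_adj x : word_span x -> word_span (adj x).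
Proof.
elim=> [|a k l p w {}x hw _ IH]; first by rewrite adj0; exact: Span0.
by rewrite adjD Defs.adjZ; apply: SpanD (monomial_adj hw) IH.
Qed.

Lemma word_span_dense : cstar_generates [set U; S]%classic ->
  forall x (e : R), 0 < e -> exists2 q, word_span q & cnorm (x - q) <= e.
Proof.
move=> hgen.
pose P := [set x : A | forall e : R, 0 < e ->
  exists2 q, word_span q & cnorm (x - q) <= e]%classic.
have Pspan x : word_span x -> P x.
  by move=> hx e e0; exists x => //; rewrite subrr cnorm0 ltW.
suff PT : P = setT by move=> x; have : P x by rewrite PT.
apply: hgen; last first.
  by move=> x [->|->]; apply: Pspan; apply: word_span_monomial;
     [exact: MonoU|exact: MonoS].
split.
- move=> u l Pu ul e e0; have e2 : 0 < e / 2 by lra.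
  have /cvgr0Pnorm_lt/(_ _ e2)[n _ /(_ n (leqnn n)) /= hn] := ul.
  have [q hq hq2] := Pu n _ e2; exists q => //.
  move: hn; rewrite ger0_norm ?cnorm_ge0 // => hn.
  have := cnormB (u n - q) (u n - l).
  by rewrite opprB [_ + (l - _)]addrC addrA subrK => h; lra.
- exact/Pspan/word_span_monomial/Mono1.
- move=> a x y Px Py e e0; have e2 : 0 < e / 2 by lra.
  have [d d0 hd] := exists_small_factor (normc_ge0 a) e2.
  have [q hq xq] := Px _ d0; have [q' hq' yq] := Py _ e2.
  exists (a *: q + q'); first exact: word_span_linear.
  rewrite opprD addrACA -scalerBr; apply: le_trans (cnormD _ _) _.
  have : Normc.normc a * cnorm (x - q) <= Normc.normc a * d.
    by rewrite ler_wpM2l // normc_ge0.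
  by rewrite cnormZ => h; lra.
- move=> x y Px Py e e0; have e2 : 0 < e / 2 by lra.
  have [d d0 hd] := exists_small_factor (cnorm_ge0 x) e2.
  have [q' hq' yq] := Py _ d0.
  have [d' d'0 hd'] := exists_small_factor (cnorm_ge0 q') e2.
  have [q hq xq] := Px _ d'0.
  exists (q * q'); first exact: word_spanM.
  have -> : x * y - q * q' = x * (y - q') + (x - q) * q'.
    by rewrite mulrBr mulrBl addrA subrK.
  apply: le_trans (cnormD _ _) _.
  have h1 := le_trans (cnormM x (y - q')) (ler_wpM2l (cnorm_ge0 x) yq).
  have h2 := le_trans (cnormM (x - q) q') (ler_wpM2r (cnorm_ge0 q') xq).
  lra.
- move=> x Px e e0; have [q hq xq] := Px _ e0.
  exists (adj q); first exact: word_span_adj.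
  have -> : adj x - adj q = adj (x - q).
    by rewrite -scaleN1r adjD -[in RHS]scaleN1r Defs.adjZ rmorphN1.
  by rewrite cnorm_adjE.
Qed.

(** * Sums along the orbits of the twist *)

Variable z : R[i].
Hypothesis z1 : Normc.normc z = 1.

Definition twist (y : A) : A := z^-1 *: (adj U ^+ 2 * y * U).

Definition orbit_sum N (y : A) : A := \sum_(r < N) iter r twist y.

Lemma iter_twistE r y :
  iter r twist y = z^-1 ^+ r *: (adj U ^+ (2 * r) * y * U ^+ r).
Proof.
elim: r => [|r IH]; first by rewrite scale1r mul1r mulr1.
rewrite iterS IH /twist -scalerAr -scalerAl scalerA -exprS.
by rewrite mulnS exprD (exprSr U) !mulrA.
Qed.

Lemma iter_twist_linear r : linear (iter r twist).
Proof.
move=> a x y; rewrite !iter_twistE mulrDr mulrDl scalerDr -scalerAr -scalerAl.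
by rewrite !scalerA mulrC.
Qed.

Lemma iter_twistZ r a x : iter r twist (a *: x) = a *: iter r twist x.
Proof.
have := iter_twist_linear r a x 0.
by rewrite addr0 [iter r twist 0]iter_twistE mulr0 mul0r scaler0 addr0.
Qed.

Lemma cnorm_iter_twist r y : cnorm (iter r twist y) <= cnorm y.
Proof.
have U1 : cnorm U <= 1 by rewrite cnorm_isometry.
have V1 : cnorm (adj U) <= 1 by rewrite cnorm_adjE.
rewrite iter_twistE cnormZ normcX Normc.normcV z1 invr1 expr1n mul1r.
apply: le_trans (cnorm_mulr_le _ (cnorm_expr_le1 _ U1)) _.
exact/cnorm_mull_le/cnorm_expr_le1.
Qed.

Lemma orbit_sum_linear N : linear (orbit_sum N).
Proof.
move=> a x y; rewrite /orbit_sum scaler_sumr -big_split /=.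
by apply: eq_bigr => r _; rewrite iter_twist_linear.
Qed.

Lemma cnorm_orbit_sum N y : cnorm (orbit_sum N y) <= N%:R * cnorm y.
Proof. by apply: cnorm_sum_le => r; exact: cnorm_iter_twist. Qed.

Lemma orbit_sum_fixed N y : twist y = y -> orbit_sum N y = y *+ N.
Proof.
move=> hy; rewrite /orbit_sum (eq_bigr (fun=> y)) ?sumr_const ?card_ord //.
by move=> r _; elim: (nat_of_ord r) => //= n ->.
Qed.

(** Telescoping: (1 - mu) times the sum is the difference of the sums over
    two windows of length T, whatever N is. *)
Lemma cnorm_orbit_sum_eigen T (mu : R[i]) y : mu != 1 ->
  iter T twist y = mu *: y -> forall N,
  cnorm (orbit_sum N y) <= T%:R * (cnorm y + cnorm y) / Normc.normc (1 - mu).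
Proof.
move=> mu1 hy N.
have m0 : 0 < Normc.normc (1 - mu).
  rewrite lt_def normc_ge0 andbT; apply: contra mu1 => /eqP/Normc.eq0_normc/eqP.
  by rewrite subr_eq0 eq_sym.
rewrite ler_pdivlMr // mulrC -cnormZ scalerBl scale1r.
suff -> : orbit_sum N y - mu *: orbit_sum N y =
          \sum_(r < T) (iter r twist y - iter (N + r) twist y).
  apply: (@cnorm_sum_le _ _ T
    (fun r => iter r twist y - iter (N + r) twist y)) => r.
  apply: le_trans (cnormB _ _) _.
  by rewrite lerD ?cnorm_iter_twist.
have -> : mu *: orbit_sum N y = \sum_(r < N) iter (T + r) twist y.
  rewrite scaler_sumr; apply: eq_bigr => r _.
  by rewrite addnC iterD hy iter_twistZ.
have : \sum_(r < T + N) iter r twist y = \sum_(r < N + T) iter r twist y.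
  by rewrite addnC.
rewrite !big_split_ord /= sumrB => e.
by apply/eqP; rewrite subr_eq addrAC eq_sym subr_eq e.
Qed.

(** * Compressions by powers of S *)

Definition corner m (y : A) : A := adj S ^+ m * y * S ^+ m.

Lemma corner_linear m : linear (corner m).
Proof.
by move=> a x y; rewrite /corner mulrDr mulrDl -scalerAr -scalerAl.
Qed.

Lemma corner_sum m N (F : 'I_N -> A) :
  corner m (\sum_(r < N) F r) = \sum_(r < N) corner m (F r).
Proof. by rewrite /corner mulr_sumr mulr_suml. Qed.

Lemma cnorm_corner m y : cnorm (corner m y) <= cnorm y.
Proof.
have S1 : cnorm S <= 1 by rewrite cnorm_isometry.
have T1 : cnorm (adj S) <= 1 by rewrite cnorm_adjE.
apply: le_trans (cnorm_mulr_le _ (cnorm_expr_le1 _ S1)) _.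
exact/cnorm_mull_le/cnorm_expr_le1.
Qed.

Lemma corner1 m : corner m 1 = 1.
Proof. by rewrite /corner mulr1 isometryX. Qed.

(** The threshold m0 may depend on N, but the bound C may not. *)
Definition corner_bounded (x y : A) := exists C : R, forall N, exists m0,
  forall m, (m0 <= m)%N -> cnorm (corner m (x * orbit_sum N y)) <= C.

Lemma corner_bounded_linearl a x x' y :
  corner_bounded x y -> corner_bounded x' y -> corner_bounded (a *: x + x') y.
Proof.
move=> [C hC] [C' hC']; exists (Normc.normc a * C + C') => N.
have [[m0 h0] [m1 h1]] := (hC N, hC' N); exists (maxn m0 m1) => m.
rewrite geq_max => /andP[/h0 h0m /h1 h1m].
rewrite mulrDl -scalerAl corner_linear; apply: le_trans (cnormD _ _) _.
by rewrite cnormZ lerD // ler_wpM2l // normc_ge0.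
Qed.

Lemma corner_bounded_linearr a x y y' :
  corner_bounded x y -> corner_bounded x y' -> corner_bounded x (a *: y + y').
Proof.
move=> [C hC] [C' hC']; exists (Normc.normc a * C + C') => N.
have [[m0 h0] [m1 h1]] := (hC N, hC' N); exists (maxn m0 m1) => m.
rewrite geq_max => /andP[/h0 h0m /h1 h1m].
rewrite orbit_sum_linear mulrDr -scalerAr corner_linear.
apply: le_trans (cnormD _ _) _.
by rewrite cnormZ lerD // ler_wpM2l // normc_ge0.
Qed.

(** * Bounds for pairs of words *)

Hypothesis znr : forall n, z ^+ (2 ^ n) != 1.

Lemma iter_twist_monomial l p y : monomial l.+1 l p y ->
  iter (2 ^ l) twist y = z^-1 ^+ (2 ^ l) *: y.
Proof.
move=> hy; rewrite iter_twistE -mulrA.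
have := monomial_UX 1 hy; rewrite !muln1 => ->.
by rewrite expnS mulrA isometryX ?mul1r.
Qed.

Lemma corner_bounded_eigen k l p l' p' x y :
  monomial k l p x -> monomial l'.+1 l' p' y -> corner_bounded x y.
Proof.
move=> hx hy; eexists => N; exists 0 => m _.
apply: le_trans (cnorm_corner _ _) _.
apply: le_trans (cnorm_mull_le _ (cnorm_monomial hx)) _.
apply: (cnorm_orbit_sum_eigen _ (iter_twist_monomial hy)).
by rewrite exprVn invr_eq1.
Qed.

(** The words x (twist^r y) have pairwise distinct translation parts q r, so
    for each N and all large m at most one of the first N terms survives the
    compression. *)
Lemma corner_bounded_drift k l p k' l' p' x y : k' != l'.+1 ->
  monomial k l p x -> monomial k' l' p' y -> corner_bounded x y.
Proof.
move=> kl hx hy; exists 1 => N.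
pose q (r : nat) : int :=
  2 ^+ k * (p' + r%:Z * (2 ^+ k' - 2 ^+ l'.+1)) + 2 ^+ l' * p.
have hmono r : monomial (k + k') (l + l') (q r)
    (x * (adj U ^+ (2 * r) * y * U ^+ r)).
  exact: MonoM hx (monomial_conj r hy).
have q_inj r s : q r = 0 -> q s = 0 -> r = s.
  move=> qr qs; have : q r - q s = 0 by rewrite qr qs.
  have -> : q r - q s = 2 ^+ k * ((r%:Z - s%:Z) * (2 ^+ k' - 2 ^+ l'.+1)).
    by rewrite /q; ring.
  move/eqP; rewrite !mulf_eq0 expf_eq0 andbF /= !subr_eq0.
  case/orP => [/eqP[]//|/eqP/ieexprIn e].
  by move: kl; rewrite e ?eqxx.
have [m0 hm0] : exists m0, forall m, (m0 <= m)%N -> forall r, (r < N)%N ->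
    q r != 0 -> corner m (x * iter r twist y) = 0.
  apply: (uniform_eventually
    (Q := fun r m => q r != 0 -> corner m (x * iter r twist y) = 0)) => r.
  have [qr|qr] := eqVneq (q r) 0; first by exists 0.
  have [m1 h1] := monomial_vanish (hmono r) qr; exists m1 => m hm _.
  by rewrite iter_twistE -scalerAr /corner -scalerAr -scalerAl h1 // scaler0.
exists m0 => m hm; rewrite /orbit_sum mulr_sumr corner_sum.
have [r0 /eqP qr0|hn] := pickP (fun r : 'I_N => q r == 0).
  rewrite (bigD1 r0) //= big1 ?addr0 => [|r rr0].
    apply: le_trans (cnorm_corner _ _) _.
    apply: le_trans (cnorm_mull_le _ (cnorm_monomial hx)) _.
    exact: le_trans (cnorm_iter_twist _ _) (cnorm_monomial hy).
  apply: hm0 => //; apply: contra rr0 => /eqP qr; apply/eqP/val_inj.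
  exact: q_inj.
by rewrite big1 ?cnorm0 // => r _; apply: hm0 => //; rewrite hn.
Qed.

Lemma corner_bounded_span x y : word_span x -> word_span y -> corner_bounded x y.
Proof.
have b0 y' : corner_bounded 0 y'.
  by exists 0 => N; exists 0 => m _; rewrite mul0r /corner mulr0 mul0r cnorm0.
have b0' x' : corner_bounded x' 0.
  exists 0 => N; exists 0 => m _; apply: le_trans (cnorm_corner _ _) _.
  rewrite /orbit_sum big1 ?mulr0 ?cnorm0 // => r _.
  by rewrite iter_twistE mulr0 mul0r scaler0.
move=> hx hy; elim: hx => [|a k l p w {}x hw _ IH]; first exact: b0.
apply: corner_bounded_linearl IH.
elim: hy => [|b k' l' p' v {}y hv _ IH]; first exact: b0'.
apply: corner_bounded_linearr IH.
have [kl|kl] := eqVneq k' l'.+1; last exact: corner_bounded_drift hw hv.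
by rewrite kl in hv; exact: corner_bounded_eigen hw hv.
Qed.

(** * Isometries fixed by the twist *)

(** With Q close to T* and P close to T in the span of the words, N = N T* T
    is the sum of N (T* - Q) T, of Q times the orbit sum of T - P, and of Q
    times the orbit sum of P.  After compression the first two have norm at
    most N / 4, and the last one is bounded independently of N. *)
Lemma no_twist_fixed_isometry T : cstar_generates [set U; S]%classic ->
  Defs.isometry T -> twist T <> T.
Proof.
move=> hgen hT fT.
have q4 : 0 < 1 / 4 :> R by lra.
have [Q hQ TQ] := word_span_dense hgen (adj T) q4.
have [d d0 hd] : exists2 d : R, 0 < d & cnorm Q * d <= 1 / 4.
  exact: exists_small_factor (cnorm_ge0 Q) q4.
have [P hP TP] := word_span_dense hgen T d0.
have [C hC] := corner_bounded_span hQ hP.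
have key N : N%:R <= 2 * C.
  have [m0 /(_ m0 (leqnn _)) hm] := hC N.
  have e1 : (1 : A) *+ N = (adj T - Q) * T *+ N
      + (Q * orbit_sum N (T - P) + Q * orbit_sum N P).
    rewrite -mulrDr -[X in Q * (_ + X)]scale1r addrC.
    have -> : orbit_sum N (T - P) = orbit_sum N T - orbit_sum N P.
      by rewrite -[- P]scaleN1r addrC orbit_sum_linear scaleN1r addrC.
    rewrite scale1r subrK (orbit_sum_fixed _ fT) mulrBl hT mulrnAr -mulrnDl.
    by rewrite addrC subrK.
  have : cnorm (corner m0 (1 *+ N)) = N%:R.
    by rewrite /corner mulrnAr mulrnAl -/(corner m0 1) corner1 cnormMn cnorm1.
  have T1 : cnorm T <= 1 by rewrite cnorm_isometry.
  have hX : cnorm ((adj T - Q) * T *+ N) <= N%:R * (1 / 4).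
    rewrite cnormMn -[leLHS]mulr_natl ler_wpM2l //.
    exact: le_trans (cnorm_mulr_le _ T1) TQ.
  have hY : cnorm (Q * orbit_sum N (T - P)) <= N%:R * (1 / 4).
    apply: le_trans (cnormM _ _) _.
    apply: le_trans (ler_wpM2l (cnorm_ge0 Q) (cnorm_orbit_sum _ _)) _.
    rewrite mulrCA ler_wpM2l //; apply: le_trans hd.
    by rewrite ler_wpM2l ?cnorm_ge0.
  rewrite e1 addrA [corner _ _]/corner mulrDr mulrDl.
  rewrite -/(corner m0 _) -/(corner m0 _) => eN.
  have := cnorm_corner m0 ((adj T - Q) * T *+ N + Q * orbit_sum N (T - P)).
  have := cnormD ((adj T - Q) * T *+ N) (Q * orbit_sum N (T - P)).
  have := cnormD (corner m0 ((adj T - Q) * T *+ N + Q * orbit_sum N (T - P)))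
    (corner m0 (Q * orbit_sum N P)).
  by rewrite eN; lra.
have := key (Num.truncn (2 * C)).+1.
by rewrite leNgt truncnS_gt.
Qed.

End Q2Words.

Theorem proposition3p2 (R : realType) (Q2 : cstarAlgType R) (U S2 : Q2)
    (hQ2 : is_Q2 U S2) (alpha : Q2 -> Q2) (halpha : star_automorphism alpha)
    (z : R[i]) (hz : `|z| = 1) (hU : alpha U = z *: U) :
  exists n : nat, z ^+ (2 ^ n) = 1.
Proof.
apply: contrapT => hn.
have znr n : z ^+ (2 ^ n) != 1 by apply/eqP => e; apply: hn; exists n.
have z1 : Normc.normc z = 1.
  have : (Normc.normc z)%:C = 1 := hz.
  by case.
have z0 : z != 0 by rewrite -normr_gt0 hz.
have [hrel hgen _] := hQ2; have [[UVU UUV] SS SU _] := hrel.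
have [[_ [a1 aM] aJ] _] := halpha.
apply: (no_twist_fixed_isometry hrel z1 znr hgen (T := alpha S2)).
  by rewrite /Defs.isometry -aJ -aM SS a1.
have TU : alpha S2 * U = z *: (U ^+ 2 * alpha S2).
  apply: (scalerI z0); rewrite scalerAr -hU -aM SU !expr2 !aM hU.
  by rewrite -!scalerAl -!scalerAr -scalerAl !scalerA.
rewrite /twist -mulrA TU -scalerAr scalerA mulVf // scale1r mulrA.
by rewrite isometryX // mul1r.
Qed.
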